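(* Let $C$ be a coalgebra, let $W$ be a $C$-bicomodule, let $\delta\colon W\to C$ be a coderivation, and let $\varphi\colon W\to\mathscr{W}_1^u$ be the unique $C$-bicolinear map with $\delta^u\circ\varphi=\delta$. Then $W/\ker(\varphi)$ together with the induced coderivation $\overline\delta\colon W/\ker(\varphi)\to C$, $[w]\mapsto\delta(w)$, is a first-order codifferential calculus over $C$. Moreover, the pair $(W,\delta)$ is a first-order codifferential calculus if and only if $\varphi$ is injective.
   Context: $k$ is a field with $\mathrm{char}(k)\ne2$; everything is over $k$. In a $C$-bicomodule $W$ write $w_{(-1)}\otimes w_{(0)}$ and $w_{(0)}\otimes w_{(1)}$ for the left and right coactions. A coderivation is a linear map $\delta\colon W\to C$ with $\Delta(\delta(w))=\delta(w_{(0)})\otimes w_{(1)}+w_{(-1)}\otimes\delta(w_{(0)})$ for all $w\in W$. A first-order codifferential calculus over $C$ is a $C$-bicomodule $\mathscr{W}_1$ with a coderivation $\delta\colon\mathscr{W}_1\to C$ such that the map $\mathscr{W}_1\to C\otimes C$, $w\mapsto w_{(-1)}\otimes\delta(w_{(0)})$ is injective. The universal first-order codifferential calculus is $\mathscr{W}_1^u=(C\otimes C)/\mathrm{im}(\Delta)$ with coactions $[c\otimes d]\mapsto c_{(1)}\otimes[c_{(2)}\otimes d]$ and $[c\otimes d]\mapsto[c\otimes d_{(1)}]\otimes d_{(2)}$, and coderivation $\delta^u([c\otimes d])=\varepsilon(c)d-\varepsilon(d)c$. For every $C$-bicomodule $W$ and coderivation $\delta\colon W\to C$ there is a unique $C$-bicolinear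 $\varphi\colon W\to\mathscr{W}_1^u$ with $\delta^u\circ\varphi=\delta$; it is $\varphi(w)=[w_{(-1)}\otimes\delta(w_{(0)})]$. *)

(* Defs.v *)
From HB Require Import structures.
From mathcomp Require Import all_boot all_algebra.
From mathcomp Require Import boolp.

Set Implicit Arguments.
Unset Strict Implicit.
Unset Printing Implicit Defensive.

Import GRing.Theory.
Local Open Scope ring_scope.
Local Open Scope quotient_scope.

Reserved Notation "v ⊗ w" (at level 38, left associativity).

Section QuotientModule.
Variables (k : fieldType) (V : lmodType k) (S : submodClosed V).

Definition submod_pred : {pred V} := S.

Lemma submod_pred_closed : zmod_closed submod_pred.
Proof.
suff: zmod_closed S by [].
by split=> [|v w vS wS]; rewrite ?rpred0 // rpredD // -scaleN1r rpredZ.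
Qed.

HB.instance Definition _ :=
  GRing.isZmodClosed.Build V submod_pred submod_pred_closed.

Definition quotmod : Type := Quotient.quot submod_pred.
HB.instance Definition _ := GRing.Zmodule.on quotmod.

Definition qproj (v : V) : quotmod := \pi_(Quotient.quot submod_pred) v.
Definition qrepr (x : quotmod) : V := repr (x : Quotient.quot submod_pred).

Lemma qreprK x : qproj (qrepr x) = x.
Proof. exact: reprK. Qed.

Lemma qprojP v w : reflect (qproj v = qproj w) (v - w \in S).
Proof. by have := @Quotient.idealrBE V submod_pred v w => /= ->; apply: eqP. Qed.

Lemma qproj_eq0 v : (qproj v == 0) = (v \in S).
Proof.
have -> : (0 : quotmod) = qproj 0 by rewrite /qproj raddf0.
by apply/eqP/idP => [/qprojP|vS]; [|apply/qprojP]; rewrite subr0.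
Qed.

Let scale (a : k) (x : quotmod) : quotmod := qproj (a *: qrepr x).

Let qprojD v w : qproj (v + w) = qproj v + qproj w.
Proof. exact: raddfD. Qed.

Let qprojZ a v : qproj (a *: v) = scale a (qproj v).
Proof.
apply/qprojP; rewrite -scalerBr rpredZ //.
by apply/qprojP; rewrite qreprK.
Qed.

Let scaleA a b x : scale a (scale b x) = scale (a * b) x.
Proof. by rewrite -[x]qreprK -!qprojZ scalerA. Qed.

Let scale1 : left_id 1 scale.
Proof. by move=> x; rewrite -[x]qreprK -!qprojZ scale1r. Qed.

Let scaleDr : right_distributive scale +%R.
Proof.
by move=> a x y; rewrite -[x]qreprK -[y]qreprK -qprojD -!qprojZ -qprojD scalerDr.
Qed.

Let scaleDl x : {morph scale^~ x : a b / a + b}.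
Proof. by move=> a b; rewrite -[x]qreprK -!qprojZ -qprojD scalerDl. Qed.

HB.instance Definition _ :=
  GRing.Zmodule_isLmodule.Build k quotmod scaleA scale1 scaleDr scaleDl.

Lemma qproj_is_linear : linear qproj.
Proof. by move=> a v w; rewrite qprojD qprojZ. Qed.

HB.instance Definition _ := GRing.isLinear.Build k V quotmod _ qproj
  qproj_is_linear.

(* Only meaningful for a linear map f that vanishes on S. *)
Definition qlift (U : lmodType k) (f : V -> U) (x : quotmod) : U := f (qrepr x).

Lemma qliftE (U : lmodType k) (f : {linear V -> U}) :
  {in S, forall v, f v = 0} -> forall v, qlift f (qproj v) = f v.
Proof.
move=> f0 v; apply/eqP; rewrite /qlift -subr_eq0 -linearB f0 //.
by apply/qprojP; rewrite qreprK.
Qed.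

Lemma qlift_is_linear (U : lmodType k) (f : {linear V -> U}) :
  {in S, forall v, f v = 0} -> linear (qlift f).
Proof.
move=> f0 a x y; rewrite -[x]qreprK -[y]qreprK -linearP !qliftE //.
exact: linearP.
Qed.

End QuotientModule.

Arguments quotmod {k V} S.
Arguments qproj {k V} S v.

Section KernelImage.
Variables (k : fieldType) (V U : lmodType k) (f : {linear V -> U}).

Definition kerlin : {pred V} := [pred v | f v == 0].

Lemma kerlin_closed : submod_closed kerlin.
Proof.
split; first by rewrite inE linear0.
by move=> a v w /eqP v0 /eqP w0; rewrite inE linearP v0 w0 scaler0 addr0.
Qed.

HB.instance Definition _ := GRing.isSubmodClosed.Build k V kerlin kerlin_closed.

Definition imlin : {pred U} := [pred u | `[< exists v, f v = u >]].

Lemma imlin_closed : submod_closed imlin.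
Proof.
split; first by apply/asboolP; exists 0; rewrite linear0.
move=> a _ _ /asboolP[v <-] /asboolP[w <-].
by apply/asboolP; exists (a *: v + w); rewrite linearP.
Qed.

HB.instance Definition _ := GRing.isSubmodClosed.Build k U imlin imlin_closed.

Lemma imlinP u : reflect (exists v, f v = u) (u \in imlin).
Proof. exact: asboolP. Qed.

End KernelImage.

(* Elements of V ⊗ W are formal sums of pairs (v, w), identified when every   *)
(* bilinear map takes the same value on them; a scalar a acts by a *: v. The  *)
(* universal property is tliftE together with tensor_ext.                     *)

Section TensorDef.
Variables (k : fieldType) (V W : lmodType k).

Definition tensor_equiv (s t : seq (V * W)) : bool :=
  `[< forall (U : lmodType k) (b : {bilinear V -> W -> U}),
        \sum_(p <- s) b p.1 p.2 = \sum_(p <- t) b p.1 p.2 >].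

Lemma tensor_equiv_is_equiv : equiv_class_of tensor_equiv.
Proof.
split=> [s|s t|t s u]; first exact/asboolP.
- by apply/asboolP/asboolP => st U b; rewrite st.
- by move=> /asboolP st /asboolP tu; apply/asboolP => U b; rewrite st tu.
Qed.

Canonical tensor_equiv_equiv := EquivRelPack tensor_equiv_is_equiv.
Canonical tensor_encModRel := defaultEncModRel tensor_equiv.

Definition tensor : Type := {eq_quot tensor_equiv}.
HB.instance Definition _ := Choice.on tensor.

Definition tclass (s : seq (V * W)) : tensor := \pi_({eq_quot tensor_equiv}) s.
Definition trepr (t : tensor) : seq (V * W) :=
  repr (t : {eq_quot tensor_equiv}).

Definition tens (v : V) (w : W) : tensor := tclass [:: (v, w)].

Definition tlift (U : lmodType k) (b : V -> W -> U) (t : tensor) : U :=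
  \sum_(p <- trepr t) b p.1 p.2.

Lemma treprK t : tclass (trepr t) = t.
Proof. exact: reprK. Qed.

Lemma tclassP s t : tclass s = tclass t <->
  forall (U : lmodType k) (b : {bilinear V -> W -> U}),
    \sum_(p <- s) b p.1 p.2 = \sum_(p <- t) b p.1 p.2.
Proof.
split=> [/eqP|st]; last by apply/eqP; rewrite piE; apply/asboolP.
by rewrite piE => /asboolP.
Qed.

Lemma tlift_class (U : lmodType k) (b : {bilinear V -> W -> U}) s :
  tlift b (tclass s) = \sum_(p <- s) b p.1 p.2.
Proof. by have /tclassP := treprK (tclass s); apply. Qed.

Lemma tensorP t u : (forall (U : lmodType k) (b : {bilinear V -> W -> U}),
  tlift b t = tlift b u) -> t = u.
Proof. by move=> tu; rewrite -[t]treprK -[u]treprK; apply/tclassP. Qed.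

Let scale (a : k) t := tclass [seq (a *: p.1, p.2) | p <- trepr t].
Let add t u := tclass (trepr t ++ trepr u).

Let scaleE (U : lmodType k) (b : {bilinear V -> W -> U}) a t :
  tlift b (scale a t) = a *: tlift b t.
Proof.
rewrite tlift_class big_map scaler_sumr.
by apply: eq_bigr => p _ /=; rewrite linearZl_LR.
Qed.

Let addE (U : lmodType k) (b : {bilinear V -> W -> U}) t u :
  tlift b (add t u) = tlift b t + tlift b u.
Proof. by rewrite tlift_class big_cat. Qed.

Let zeroE (U : lmodType k) (b : {bilinear V -> W -> U}) : tlift b (tclass [::]) = 0.
Proof. by rewrite tlift_class big_nil. Qed.

Let addA : associative add.
Proof. by move=> t u v; apply: tensorP => U b; rewrite !addE addrA. Qed.

Let addC : commutative add.
Proof. by move=> t u; apply: tensorP => U b; rewrite !addE addrC. Qed.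

Let add0 : left_id (tclass [::]) add.
Proof. by move=> t; apply: tensorP => U b; rewrite !addE zeroE add0r. Qed.

Let addN : left_inverse (tclass [::]) (scale (-1)) add.
Proof.
by move=> t; apply: tensorP => U b; rewrite addE scaleE zeroE scaleN1r addNr.
Qed.

HB.instance Definition _ := GRing.isZmodule.Build tensor addA addC add0 addN.

Let scaleA a b t : scale a (scale b t) = scale (a * b) t.
Proof. by apply: tensorP => U f; rewrite !scaleE scalerA. Qed.

Let scale1 : left_id 1 scale.
Proof. by move=> t; apply: tensorP => U f; rewrite !scaleE scale1r. Qed.

Let scaleDr : right_distributive scale +%R.
Proof.
move=> a t u; apply: tensorP => U f.
by rewrite [RHS]addE !scaleE [in LHS]addE scalerDr.
Qed.

Let scaleDl t : {morph scale^~ t : a b / a + b}.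
Proof.
by move=> a b; apply: tensorP => U f; rewrite [RHS]addE !scaleE scalerDl.
Qed.

HB.instance Definition _ :=
  GRing.Zmodule_isLmodule.Build k tensor scaleA scale1 scaleDr scaleDl.

Lemma tlift_is_linear (U : lmodType k) (b : {bilinear V -> W -> U}) :
  linear (tlift b).
Proof. by move=> a t u; rewrite [LHS]addE [X in X + _]scaleE. Qed.

HB.instance Definition _ (U : lmodType k) (b : {bilinear V -> W -> U}) :=
  GRing.isLinear.Build k tensor U _ (tlift b) (tlift_is_linear b).

Lemma tliftE (U : lmodType k) (b : {bilinear V -> W -> U}) v w :
  tlift b (tens v w) = b v w.
Proof. by rewrite tlift_class big_seq1. Qed.

Lemma tens_is_bilinear : bilinear_for
  (GRing.Scale.Law.clone _ _ *:%R _) (GRing.Scale.Law.clone _ _ *:%R _) tens.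
Proof.
split=> [w a v v'|v a w w']; apply: tensorP => U b /=;
  rewrite [RHS]linearP /= !tliftE; [exact: linearPl|exact: linearPr].
Qed.

HB.instance Definition _ :=
  bilinear_isBilinear.Build k V W tensor _ _ tens tens_is_bilinear.

Lemma tensPl a v v' w : tens (a *: v + v') w = a *: tens v w + tens v' w.
Proof. exact: linearPl. Qed.

Lemma tensPr a v w w' : tens v (a *: w + w') = a *: tens v w + tens v w'.
Proof. exact: linearPr. Qed.

Lemma tens0l w : tens 0 w = 0. Proof. exact: linear0l. Qed.

Lemma tens0r v : tens v 0 = 0. Proof. exact: linear0r. Qed.

Lemma tensDl v v' w : tens (v + v') w = tens v w + tens v' w.
Proof. exact: linearDl. Qed.

Lemma tensDr v w w' : tens v (w + w') = tens v w + tens v w'.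
Proof. exact: linearDr. Qed.

Lemma tensZl a v w : tens (a *: v) w = a *: tens v w.
Proof. exact: linearZl_LR. Qed.

Lemma tensZr a v w : tens v (a *: w) = a *: tens v w.
Proof. exact: linearZr_LR. Qed.

Lemma tensor_sum t : t = \sum_(p <- trepr t) tens p.1 p.2.
Proof.
apply: tensorP => U b; rewrite [RHS]linear_sum /= -[in LHS](treprK t) tlift_class.
by apply: eq_bigr => p _; rewrite tliftE.
Qed.

Lemma tensor_ind (P : tensor -> Prop) : P 0 ->
  (forall t u, P t -> P u -> P (t + u)) -> (forall v w, P (tens v w)) ->
  forall t, P t.
Proof. by move=> P0 PD Pt t; rewrite (tensor_sum t); apply: big_ind. Qed.

Lemma tensor_ext (U : lmodType k) (f g : {linear tensor -> U}) :
  (forall v w, f (tens v w) = g (tens v w)) -> f =1 g.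
Proof.
move=> fg; apply: tensor_ind => //; first by rewrite !linear0.
by move=> t u ft fu; rewrite !linearD ft fu.
Qed.

End TensorDef.

Arguments tensor {k} (V W)%_type_scope.
Notation "V ⊗ W" := (tensor V W) : type_scope.
Notation "v ⊗ w" := (tens v w) : ring_scope.

Section TensorMaps.
Variable k : fieldType.
Implicit Types U V W : lmodType k.

Section Map.
Variables V V' W W' : lmodType k.

Definition tmap_fun (f : V -> V') (g : W -> W') v w : V' ⊗ W' := f v ⊗ g w.

Lemma tmap_fun_is_bilinear (f : {linear V -> V'}) (g : {linear W -> W'}) :
  bilinear_for (GRing.Scale.Law.clone _ _ *:%R _)
    (GRing.Scale.Law.clone _ _ *:%R _) (tmap_fun f g).
Proof.
by split=> [w a v v'|v a w w']; rewrite /tmap_fun linearP ?tensPl ?tensPr.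
Qed.

HB.instance Definition _ (f : {linear V -> V'}) (g : {linear W -> W'}) :=
  bilinear_isBilinear.Build k V W (V' ⊗ W')%type _ _ (tmap_fun f g)
    (tmap_fun_is_bilinear f g).

(* The map f ⊗ g; only meaningful for linear f and g. *)
Definition tmap (f : V -> V') (g : W -> W') : V ⊗ W -> V' ⊗ W' :=
  tlift (tmap_fun f g).

HB.instance Definition _ (f : {linear V -> V'}) (g : {linear W -> W'}) :=
  GRing.Linear.on (tmap f g).

Lemma tmapE (f : {linear V -> V'}) (g : {linear W -> W'}) v w :
  tmap f g (v ⊗ w) = f v ⊗ g w.
Proof. exact: tliftE. Qed.

End Map.

Section Unitors.
Variable V : lmodType k.

Definition tunitl_fun (a : k^o) (v : V) : V := a *: v.
Definition tunitr_fun (v : V) (a : k^o) : V := a *: v.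

Lemma tunitl_fun_is_bilinear : bilinear_for (GRing.Scale.Law.clone _ _ *:%R _)
    (GRing.Scale.Law.clone _ _ *:%R _) tunitl_fun.
Proof.
split=> [v a b c|b a v w]; rewrite /= /tunitl_fun.
  by rewrite scalerDl scalerA.
by rewrite scalerDr !scalerA mulrC.
Qed.

HB.instance Definition _ := bilinear_isBilinear.Build k k^o V V _ _
  tunitl_fun tunitl_fun_is_bilinear.

Lemma tunitr_fun_is_bilinear : bilinear_for (GRing.Scale.Law.clone _ _ *:%R _)
    (GRing.Scale.Law.clone _ _ *:%R _) tunitr_fun.
Proof.
split=> [b a v w|v a b c]; rewrite /= /tunitr_fun.
  by rewrite scalerDr !scalerA mulrC.
by rewrite scalerDl scalerA.
Qed.

HB.instance Definition _ := bilinear_isBilinear.Build k V k^o V _ _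
  tunitr_fun tunitr_fun_is_bilinear.

Definition tunitl : k^o ⊗ V -> V := tlift tunitl_fun.
HB.instance Definition _ := GRing.Linear.on tunitl.

Definition tunitr : V ⊗ k^o -> V := tlift tunitr_fun.
HB.instance Definition _ := GRing.Linear.on tunitr.

Lemma tunitlE a v : tunitl (a ⊗ v) = a *: v.
Proof. exact: tliftE. Qed.

Lemma tunitrE v a : tunitr (v ⊗ a) = a *: v.
Proof. exact: tliftE. Qed.

End Unitors.

Section Associator.
Variables U V W : lmodType k.

Definition tassoc_fun2 (w : W) (u : U) (v : V) : U ⊗ (V ⊗ W) := u ⊗ (v ⊗ w).

Lemma tassoc_fun2_is_bilinear w : bilinear_for
  (GRing.Scale.Law.clone _ _ *:%R _) (GRing.Scale.Law.clone _ _ *:%R _)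
  (tassoc_fun2 w).
Proof.
by split=> [v a u u'|u a v v']; rewrite /tassoc_fun2 ?tensPl ?tensPr.
Qed.

HB.instance Definition _ w := bilinear_isBilinear.Build k U V
  (U ⊗ (V ⊗ W))%type _ _ (tassoc_fun2 w) (tassoc_fun2_is_bilinear w).

Definition tassoc_fun (t : U ⊗ V) (w : W) : U ⊗ (V ⊗ W) :=
  tlift (tassoc_fun2 w) t.

Lemma tassoc_fun_is_bilinear : bilinear_for
  (GRing.Scale.Law.clone _ _ *:%R _) (GRing.Scale.Law.clone _ _ *:%R _)
  tassoc_fun.
Proof.
split=> [w a t t'|t a w w']; rewrite /tassoc_fun ?linearP //.
elim/tensor_ind: t => [|t t' IH IH'|u v].
- by rewrite !linear0 /= scaler0 addr0.
- by rewrite !linearD /= IH IH' /= scalerDr addrACA.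
- by rewrite !tliftE /= /tassoc_fun2 !tensPr.
Qed.

HB.instance Definition _ := bilinear_isBilinear.Build k (U ⊗ V)%type W
  (U ⊗ (V ⊗ W))%type _ _ tassoc_fun tassoc_fun_is_bilinear.

Definition tassoc : (U ⊗ V) ⊗ W -> U ⊗ (V ⊗ W) := tlift tassoc_fun.
HB.instance Definition _ := GRing.Linear.on tassoc.

Lemma tassocE u v w : tassoc ((u ⊗ v) ⊗ w) = u ⊗ (v ⊗ w).
Proof. by rewrite /tassoc !tliftE /= /tassoc_fun tliftE. Qed.

Definition tassocV_fun2 (u : U) (v : V) (w : W) : (U ⊗ V) ⊗ W := (u ⊗ v) ⊗ w.

Lemma tassocV_fun2_is_bilinear u : bilinear_for
  (GRing.Scale.Law.clone _ _ *:%R _) (GRing.Scale.Law.clone _ _ *:%R _)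
  (tassocV_fun2 u).
Proof.
by split=> [w a v v'|v a w w']; rewrite /tassocV_fun2 ?tensPr ?tensPl.
Qed.

HB.instance Definition _ u := bilinear_isBilinear.Build k V W
  ((U ⊗ V) ⊗ W)%type _ _ (tassocV_fun2 u) (tassocV_fun2_is_bilinear u).

Definition tassocV_fun (u : U) (t : V ⊗ W) : (U ⊗ V) ⊗ W :=
  tlift (tassocV_fun2 u) t.

Lemma tassocV_fun_is_bilinear : bilinear_for
  (GRing.Scale.Law.clone _ _ *:%R _) (GRing.Scale.Law.clone _ _ *:%R _)
  tassocV_fun.
Proof.
split=> [t a u u'|u a t t']; rewrite /tassocV_fun ?linearP //.
elim/tensor_ind: t => [|t t' IH IH'|v w].
- by rewrite !linear0 /= scaler0 addr0.
- by rewrite !linearD /= IH IH' /= scalerDr addrACA.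
- by rewrite !tliftE /= /tassocV_fun2 !tensPl.
Qed.

HB.instance Definition _ := bilinear_isBilinear.Build k U (V ⊗ W)%type
  ((U ⊗ V) ⊗ W)%type _ _ tassocV_fun tassocV_fun_is_bilinear.

Definition tassocV : U ⊗ (V ⊗ W) -> (U ⊗ V) ⊗ W := tlift tassocV_fun.
HB.instance Definition _ := GRing.Linear.on tassocV.

Lemma tassocVE u v w : tassocV (u ⊗ (v ⊗ w)) = (u ⊗ v) ⊗ w.
Proof. by rewrite /tassocV !tliftE /= /tassocV_fun tliftE. Qed.

End Associator.

Lemma eq_tmap V V' W W' (f f' : V -> V') (g g' : W -> W') :
  f =1 f' -> g =1 g' -> tmap f g =1 tmap f' g'.
Proof. by move=> /funext -> /funext ->. Qed.

Lemma tmap_id V W : tmap (@idfun V) (@idfun W) =1 id.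
Proof. by apply: (tensor_ext (g := idfun)) => v w /=; rewrite tmapE. Qed.

Lemma tmap_comp V V' V'' W W' W'' (f : {linear V -> V'}) (g : {linear W -> W'})
    (f' : {linear V' -> V''}) (g' : {linear W' -> W''}) t :
  tmap f' g' (tmap f g t) = tmap (f' \o f) (g' \o g) t.
Proof.
apply: (tensor_ext (f := tmap f' g' \o tmap f g)) => v w.
by rewrite /= !tmapE.
Qed.

Section AssociatorInverse.
Variables U V W : lmodType k.

Lemma tassocK : cancel (@tassoc U V W) (@tassocV U V W).
Proof.
apply: (tensor_ext (f := @tassocV U V W \o @tassoc U V W) (g := idfun)) => t w.
elim/tensor_ind: t => [|t t' IH IH'|u v] /=.
- by rewrite tens0l !linear0.
- by move: IH IH'; rewrite tensDl !linearD /= => -> ->.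
- by rewrite tassocE tassocVE.
Qed.

Lemma tassocVK : cancel (@tassocV U V W) (@tassoc U V W).
Proof.
apply: (tensor_ext (f := @tassoc U V W \o @tassocV U V W) (g := idfun)) => u t.
elim/tensor_ind: t => [|t t' IH IH'|v w] /=.
- by rewrite tens0r !linear0.
- by move: IH IH'; rewrite tensDr !linearD /= => -> ->.
- by rewrite tassocVE tassocE.
Qed.

End AssociatorInverse.

Section AssociatorTheory.
Variables U V W X : lmodType k.

Lemma tassoc_nat U' V' W' (f : {linear U -> U'}) (g : {linear V -> V'})
    (h : {linear W -> W'}) t :
  tassoc (tmap (tmap f g) h t) = tmap f (tmap g h) (tassoc t).
Proof.
apply: (tensor_ext (f := @tassoc U' V' W' \o tmap (tmap f g) h)
  (g := tmap f (tmap g h) \o @tassoc U V W)) => {}t w.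
elim/tensor_ind: t => [|t t' IH IH'|u v].
- by rewrite tens0l !linear0.
- by move: IH IH'; rewrite tensDl !linearD /= => -> ->.
- by do 4 rewrite /= ?(tmapE, tassocE).
Qed.

Lemma tassocV_nat U' V' W' (f : {linear U -> U'}) (g : {linear V -> V'})
    (h : {linear W -> W'}) t :
  tassocV (tmap f (tmap g h) t) = tmap (tmap f g) h (tassocV t).
Proof. by rewrite -[in LHS](tassocVK t) -tassoc_nat tassocK. Qed.

Lemma tassoc_pentagon (t : ((U ⊗ V) ⊗ W) ⊗ X) :
  tmap idfun (@tassoc V W X) (tassoc (tmap (@tassoc U V W) idfun t)) =
  tassoc (tassoc t).
Proof.
apply: (tensor_ext
  (f := tmap idfun (@tassoc V W X) \o @tassoc U (V ⊗ W)%type X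
        \o tmap (@tassoc U V W) idfun)
  (g := @tassoc U V (W ⊗ X)%type \o @tassoc (U ⊗ V)%type W X)) => {}t x.
elim/tensor_ind: t => [|t t' IH IH'|t w].
- by rewrite tens0l !linear0.
- by move: IH IH'; rewrite tensDl !linearD /= => -> ->.
elim/tensor_ind: t => [|t t' IH IH'|u v].
- by rewrite !tens0l !linear0.
- by move: IH IH'; rewrite !tensDl !linearD /= => -> ->.
- by do 4 rewrite /= ?(tmapE, tassocE).
Qed.

Lemma tassocV_pentagon (t : U ⊗ (V ⊗ (W ⊗ X))) :
  tmap (@tassocV U V W) idfun (tassocV (tmap idfun (@tassocV V W X) t)) =
  tassocV (tassocV t).
Proof.
apply: (can_inj (@tassocK _ _ _)); apply: (can_inj (@tassocK _ _ _)).
rewrite !tassocVK -tassoc_pentagon.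
rewrite (tmap_comp _ _ (@tassoc U V W) idfun).
rewrite (eq_tmap (f' := idfun) (g' := idfun) (@tassocVK _ _ _) (frefl _)).
rewrite tmap_id tassocVK tmap_comp.
by rewrite (eq_tmap (f' := idfun) (g' := idfun) (frefl _) (@tassocVK _ _ _)) tmap_id.
Qed.

Lemma tassoc_mid (t : (U ⊗ V) ⊗ (W ⊗ X)) :
  tassoc (tmap (@tassoc U V W) idfun (tassocV t)) =
  tmap idfun (@tassocV V W X) (tassoc t).
Proof.
rewrite -[in RHS](tassocVK t) -tassoc_pentagon tmap_comp.
by rewrite (eq_tmap (f' := idfun) (g' := idfun) (frefl _) (@tassocK _ _ _)) tmap_id.
Qed.

Lemma tunitl_assoc (t : (k^o ⊗ V) ⊗ W) :
  tunitl (tassoc t) = tmap (@tunitl V) idfun t.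
Proof.
apply: (tensor_ext (f := @tunitl (V ⊗ W)%type \o @tassoc k^o V W)) => {}t w.
elim/tensor_ind: t => [|t t' IH IH'|a v].
- by rewrite tens0l !linear0.
- by move: IH IH'; rewrite tensDl !linearD /= => -> ->.
- by rewrite /= tassocE tmapE /= !tunitlE tensZl.
Qed.

Lemma tunitr_assocV (t : V ⊗ (W ⊗ k^o)) :
  tunitr (tassocV t) = tmap idfun (@tunitr W) t.
Proof.
apply: (tensor_ext (f := @tunitr (V ⊗ W)%type \o @tassocV V W k^o)) => v {}t.
elim/tensor_ind: t => [|t t' IH IH'|w a].
- by rewrite tens0r !linear0.
- by move: IH IH'; rewrite tensDr !linearD /= => -> ->.
- by rewrite /= tassocVE tmapE /= !tunitrE tensZr.
Qed.

End AssociatorTheory.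

End TensorMaps.

Record coalgebra (k : fieldType) := Coalgebra {
  coalg_sort :> lmodType k;
  comul : {linear coalg_sort -> (coalg_sort ⊗ coalg_sort)%type};
  counit : {linear coalg_sort -> k^o};
  comulA : forall c,
    tassoc (tmap comul idfun (comul c)) = tmap idfun comul (comul c);
  counitl : forall c, tunitl (tmap counit idfun (comul c)) = c;
  counitr : forall c, tunitr (tmap idfun counit (comul c)) = c
}.

(* The last axiom says that the two coactions commute. *)
Record bicomod_struct (k : fieldType) (C : coalgebra k) (W : lmodType k) :=
  BicomodStruct {
  lcoact : {linear W -> (C ⊗ W)%type};
  rcoact : {linear W -> (W ⊗ C)%type};
  lcoactA : forall w,
    tassoc (tmap (comul C) idfun (lcoact w)) = tmap idfun lcoact (lcoact w);
  lcoact_counit : forall w, tunitl (tmap (counit C) idfun (lcoact w)) = w;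
  rcoactA : forall w,
    tassoc (tmap rcoact idfun (rcoact w)) = tmap idfun (comul C) (rcoact w);
  rcoact_counit : forall w, tunitr (tmap idfun (counit C) (rcoact w)) = w;
  coactA : forall w,
    tassoc (tmap lcoact idfun (rcoact w)) = tmap idfun rcoact (lcoact w)
}.

Record bicomodule (k : fieldType) (C : coalgebra k) := Bicomodule {
  bicomod_sort :> lmodType k;
  bicomod_class :> bicomod_struct C bicomod_sort
}.

Definition bicolinear (k : fieldType) (C : coalgebra k) (V W : bicomodule C)
    (f : {linear V -> W}) : Prop :=
  (forall v, lcoact W (f v) = tmap idfun f (lcoact V v)) /\
  (forall v, rcoact W (f v) = tmap f idfun (rcoact V v)).

Definition coderivation (k : fieldType) (C : coalgebra k) (W : bicomodule C)
    (delta : {linear W -> C}) : Prop :=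
  forall w, comul C (delta w) =
    tmap delta idfun (rcoact W w) + tmap idfun delta (lcoact W w).

Definition focodc (k : fieldType) (C : coalgebra k) (W : bicomodule C)
    (delta : {linear W -> C}) : Prop :=
  coderivation delta /\ injective (fun w => tmap idfun delta (lcoact W w)).

Section QuotientBicomodule.
Variables (k : fieldType) (C : coalgebra k) (W : bicomodule C).
Variable S : submodClosed W.

Let proj : {linear W -> quotmod S} := qproj S.

Definition lcoact_proj : W -> C ⊗ quotmod S := tmap idfun proj \o lcoact W.
HB.instance Definition _ := GRing.Linear.on lcoact_proj.

Definition rcoact_proj : W -> quotmod S ⊗ C := tmap proj idfun \o rcoact W.
HB.instance Definition _ := GRing.Linear.on rcoact_proj.

Hypothesis S_lcoact : {in S, forall w, lcoact_proj w = 0}.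
Hypothesis S_rcoact : {in S, forall w, rcoact_proj w = 0}.

Let ql : quotmod S -> C ⊗ quotmod S := qlift lcoact_proj.
HB.instance Definition _ := GRing.isLinear.Build k (quotmod S)
  (C ⊗ quotmod S)%type _ ql (qlift_is_linear S_lcoact).

Let qr : quotmod S -> quotmod S ⊗ C := qlift rcoact_proj.
HB.instance Definition _ := GRing.isLinear.Build k (quotmod S)
  (quotmod S ⊗ C)%type _ qr (qlift_is_linear S_rcoact).

Let qlE w : ql (proj w) = tmap idfun proj (lcoact W w).
Proof. exact: qliftE. Qed.

Let qrE w : qr (proj w) = tmap proj idfun (rcoact W w).
Proof. exact: qliftE. Qed.

Let qlA x :
  tassoc (tmap (comul C) idfun (ql x)) = tmap idfun ql (ql x).
Proof.
rewrite -[x]qreprK -/(proj _) !qlE.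
set t := lcoact W _; rewrite !tmap_comp.
rewrite (eq_tmap (f' := idfun) (g' := tmap idfun proj \o lcoact W) (frefl _) qlE).
have -> : tmap (comul C \o idfun) (idfun \o proj) t =
  tmap (tmap idfun idfun) proj (tmap (comul C) idfun t).
  rewrite tmap_comp; apply: eq_tmap => // c; exact/esym/tmap_id.
rewrite tassoc_nat lcoactA tmap_comp.
exact: eq_tmap.
Qed.

Let qrA x :
  tassoc (tmap qr idfun (qr x)) = tmap idfun (comul C) (qr x).
Proof.
rewrite -[x]qreprK -/(proj _) !qrE.
set t := rcoact W _; rewrite !tmap_comp.
rewrite (eq_tmap (f' := tmap proj idfun \o rcoact W) (g' := idfun) qrE (frefl _)).
have -> : tmap (idfun \o proj) (comul C \o idfun) t =
  tmap proj (tmap idfun idfun) (tmap idfun (comul C) t).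
  rewrite tmap_comp; apply: eq_tmap => // c; exact/esym/tmap_id.
rewrite -rcoactA -tassoc_nat tmap_comp.
by congr tassoc; apply: eq_tmap.
Qed.

Let qlr x : tassoc (tmap ql idfun (qr x)) = tmap idfun qr (ql x).
Proof.
rewrite -[x]qreprK -/(proj _) qlE qrE !tmap_comp.
rewrite (eq_tmap (f' := tmap idfun proj \o lcoact W) (g' := idfun) qlE (frefl _)).
rewrite (eq_tmap (f' := idfun) (g' := tmap proj idfun \o rcoact W) (frefl _) qrE).
rewrite -[tmap (_ \o _) _ _](tmap_comp (lcoact W) idfun (tmap idfun proj) idfun).
rewrite tassoc_nat coactA tmap_comp.
exact: eq_tmap.
Qed.

Let ql_counit x : tunitl (tmap (counit C) idfun (ql x)) = x.
Proof.
rewrite -[x]qreprK -/(proj _) qlE tmap_comp.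
rewrite -[in RHS](lcoact_counit W (qrepr x)).
elim/tensor_ind: (lcoact W _) => [|t t' IH IH'|c w].
- by rewrite !linear0.
- by move: IH IH'; rewrite !linearD /= => -> ->.
- by rewrite !tmapE /= !tunitlE linearZ.
Qed.

Let qr_counit x : tunitr (tmap idfun (counit C) (qr x)) = x.
Proof.
rewrite -[x]qreprK -/(proj _) qrE tmap_comp.
rewrite -[in RHS](rcoact_counit W (qrepr x)).
elim/tensor_ind: (rcoact W _) => [|t t' IH IH'|c w].
- by rewrite !linear0.
- by move: IH IH'; rewrite !linearD /= => -> ->.
- by rewrite !tmapE /= !tunitrE linearZ.
Qed.

Definition quot_bicomod : bicomodule C :=
  Bicomodule (BicomodStruct qlA ql_counit qrA qr_counit qlr).

End QuotientBicomodule.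

Section UniversalCalculus.
Variables (k : fieldType) (C : coalgebra k).

Local Notation CC := (tensor C C).
Local Notation Delta := (comul C).

(* C ⊗ C with the coactions c ⊗ d |-> c(1) ⊗ (c(2) ⊗ d) and                    *)
(* c ⊗ d |-> (c ⊗ d(1)) ⊗ d(2), before passing to the quotient by im Delta.    *)
Definition cofree_lcoact : CC -> C ⊗ CC :=
  @tassoc k C C C \o tmap Delta (@idfun C).
HB.instance Definition _ := GRing.Linear.on cofree_lcoact.

Definition cofree_rcoact : CC -> CC ⊗ C :=
  @tassocV k C C C \o tmap (@idfun C) Delta.
HB.instance Definition _ := GRing.Linear.on cofree_rcoact.

Let cofree_lcoactA t : tassoc (tmap Delta idfun (cofree_lcoact t)) =
  tmap idfun cofree_lcoact (cofree_lcoact t).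
Proof.
have -> : tmap Delta idfun (cofree_lcoact t) =
    tassoc (tmap (tmap Delta idfun) idfun (tmap Delta idfun t)).
  rewrite tassoc_nat; apply: eq_tmap => // x; exact/esym/tmap_id.
rewrite -tassoc_pentagon !tmap_comp.
rewrite (eq_tmap (f' := tmap idfun Delta \o Delta) (g' := idfun) _ (frefl _)); last exact: comulA.
rewrite -[tmap _ _ t](tmap_comp Delta idfun (tmap idfun Delta) idfun).
by rewrite tassoc_nat tmap_comp; apply: eq_tmap.
Qed.

Let comulAV c : tassocV (tmap idfun Delta (Delta c)) = tmap Delta idfun (Delta c).
Proof. by rewrite -comulA tassocK. Qed.

Let cofree_rcoactA t : tassoc (tmap cofree_rcoact idfun (cofree_rcoact t)) =
  tmap idfun Delta (cofree_rcoact t).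
Proof.
apply: (can_inj (@tassocVK _ _ _ _)); rewrite tassocK.
have -> : tmap idfun Delta (cofree_rcoact t) =
    tassocV (tmap idfun (tmap idfun Delta) (tmap idfun Delta t)).
  rewrite tassocV_nat; apply: eq_tmap => // x; exact/esym/tmap_id.
rewrite -tassocV_pentagon !tmap_comp.
rewrite (eq_tmap (f' := idfun) (g' := tmap Delta idfun \o Delta) (frefl _)); last exact: comulAV.
rewrite -[tmap _ _ t](tmap_comp idfun Delta idfun (tmap Delta idfun)).
by rewrite tassocV_nat tmap_comp; apply: eq_tmap.
Qed.

Let cofree_coactA t : tassoc (tmap cofree_lcoact idfun (cofree_rcoact t)) =
  tmap idfun cofree_rcoact (cofree_lcoact t).
Proof.
have tE : tmap Delta Delta t = tmap (tmap idfun idfun) Delta (tmap Delta idfun t).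
  rewrite tmap_comp; apply: eq_tmap => // c; exact/esym/tmap_id.
have tE' : tmap Delta Delta t = tmap Delta (tmap idfun idfun) (tmap idfun Delta t).
  rewrite tmap_comp; apply: eq_tmap => // c; exact/esym/tmap_id.
rewrite -[LHS]/(tassoc (tmap cofree_lcoact idfun (tassocV (tmap idfun Delta t)))).
rewrite -[tmap cofree_lcoact _ _](tmap_comp (tmap Delta idfun) idfun
  (@tassoc k C C C) idfun).
rewrite -tassocV_nat -tE' tassoc_mid tE tassoc_nat tmap_comp.
exact: eq_tmap.
Qed.

Let cofree_lcoact_counit t :
  tunitl (tmap (counit C) idfun (cofree_lcoact t)) = t.
Proof.
have -> : tmap (counit C) idfun (cofree_lcoact t) =
    tassoc (tmap (tmap (counit C) idfun) idfun (tmap Delta idfun t)).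
  rewrite tassoc_nat; apply: eq_tmap => // x; exact/esym/tmap_id.
rewrite tunitl_assoc !tmap_comp -[RHS]tmap_id.
by apply: eq_tmap => // c; exact: counitl.
Qed.

Let cofree_rcoact_counit t :
  tunitr (tmap idfun (counit C) (cofree_rcoact t)) = t.
Proof.
have -> : tmap idfun (counit C) (cofree_rcoact t) =
    tassocV (tmap idfun (tmap idfun (counit C)) (tmap idfun Delta t)).
  rewrite tassocV_nat; apply: eq_tmap => // x; exact/esym/tmap_id.
rewrite tunitr_assocV !tmap_comp -[RHS]tmap_id.
by apply: eq_tmap => // c; exact: counitr.
Qed.

Definition cofree_bicomod : bicomodule C :=
  Bicomodule (BicomodStruct cofree_lcoactA cofree_lcoact_counit
    cofree_rcoactA cofree_rcoact_counit cofree_coactA).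

Definition im_comul : submodClosed CC := imlin Delta.

Lemma im_comul_lcoact :
  {in im_comul, forall t,
  lcoact_proj (im_comul : submodClosed cofree_bicomod) t = 0}.
Proof.
move=> _ /imlinP[c <-]; rewrite /lcoact_proj /= /cofree_lcoact /= comulA tmap_comp.
apply: etrans (_ : tmap idfun \0 (Delta c) = 0).
  apply: eq_tmap => // d; apply/eqP; rewrite qproj_eq0; apply/imlinP; by exists d.
elim/tensor_ind: (Delta c) => [|t t' IH IH'|v w].
- by rewrite linear0.
- by move: IH IH'; rewrite linearD /= => -> ->; rewrite addr0.
- by rewrite tmapE tens0r.
Qed.

Lemma im_comul_rcoact :
  {in im_comul, forall t,
  rcoact_proj (im_comul : submodClosed cofree_bicomod) t = 0}.
Proof.
move=> _ /imlinP[c <-]; rewrite /rcoact_proj /= /cofree_rcoact /= comulAV tmap_comp.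
apply: etrans (_ : tmap \0 idfun (Delta c) = 0).
  apply: eq_tmap => // d; apply/eqP; rewrite qproj_eq0; apply/imlinP; by exists d.
elim/tensor_ind: (Delta c) => [|t t' IH IH'|v w].
- by rewrite linear0.
- by move: IH IH'; rewrite linearD /= => -> ->; rewrite addr0.
- by rewrite tmapE tens0l.
Qed.

Definition univ_codiff : bicomodule C :=
  quot_bicomod (S := im_comul : submodClosed cofree_bicomod)
    im_comul_lcoact im_comul_rcoact.

Definition cofree_coder : CC -> C :=
  (@tunitl k C \o tmap (counit C) idfun) \- (@tunitr k C \o tmap idfun (counit C)).
HB.instance Definition _ := GRing.Linear.on cofree_coder.

Lemma im_comul_coder : {in im_comul, forall t, cofree_coder t = 0}.
Proof.
by move=> _ /imlinP[c <-]; rewrite /cofree_coder /= counitl counitr subrr.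
Qed.

Definition univ_coder : univ_codiff -> C := qlift cofree_coder.
HB.instance Definition _ := GRing.isLinear.Build k univ_codiff C _ univ_coder
  (qlift_is_linear im_comul_coder).

Definition univ_proj : CC -> univ_codiff := qproj im_comul.
HB.instance Definition _ := GRing.Linear.on univ_proj.

Lemma univ_lcoactE c d : lcoact univ_codiff (univ_proj (c ⊗ d)) =
  tmap idfun univ_proj (tassoc (Delta c ⊗ d)).
Proof.
apply: etrans (qliftE im_comul_lcoact _) _.
by rewrite /lcoact_proj /= /cofree_lcoact /= tmapE.
Qed.

Lemma univ_rcoactE c d : rcoact univ_codiff (univ_proj (c ⊗ d)) =
  tmap univ_proj idfun (tassocV (c ⊗ Delta d)).
Proof.
apply: etrans (qliftE im_comul_rcoact _) _.
by rewrite /rcoact_proj /= /cofree_rcoact /= tmapE.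
Qed.

Lemma univ_coderE c d : univ_coder (univ_proj (c ⊗ d)) =
  (counit C c : k) *: d - (counit C d : k) *: c.
Proof.
apply: etrans (qliftE im_comul_coder _) _.
rewrite -[LHS]/(tunitl (tmap _ _ _) - tunitr (tmap _ _ _)).
by rewrite !tmapE tunitlE tunitrE.
Qed.

Let univ_coder_proj t : univ_coder (univ_proj t) = cofree_coder t.
Proof. exact: (qliftE im_comul_coder). Qed.

Let cofree_coderE c d :
  cofree_coder (c ⊗ d) = (counit C c : k) *: d - (counit C d : k) *: c.
Proof. by rewrite -univ_coder_proj univ_coderE. Qed.

Let coder_lcoact c d : tmap idfun cofree_coder (cofree_lcoact (c ⊗ d)) =
  c ⊗ d - (counit C d : k) *: Delta c.
Proof.
rewrite /cofree_lcoact /= tmapE /= -[in c ⊗ d](counitr c).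
elim/tensor_ind: (Delta c) => [|t t' IH IH'|a b].
- by rewrite tens0l !linear0 tens0l addr0.
- move: IH IH'; rewrite tensDl !linearD /= tensDl => -> ->.
  by rewrite addrACA.
rewrite tassocE !tmapE /= cofree_coderE tunitrE tensDr -scaleNr !tensZr.
by rewrite tensZl scaleNr.
Qed.

Let coder_rcoact c d : tmap cofree_coder idfun (cofree_rcoact (c ⊗ d)) =
  (counit C c : k) *: Delta d - c ⊗ d.
Proof.
rewrite /cofree_rcoact /= tmapE /= -[in c ⊗ d](counitl d).
elim/tensor_ind: (Delta d) => [|t t' IH IH'|a b].
- by rewrite tens0r !linear0 tens0r subr0.
- move: IH IH'; rewrite tensDr !linearD /= tensDr => -> ->.
  by rewrite opprD addrACA.
rewrite tassocVE !tmapE /= cofree_coderE tunitlE tensDl -scaleNr !tensZl.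
by rewrite tensZr scaleNr.
Qed.

Let tmap_univ_coderl t : tmap univ_coder idfun (tmap univ_proj (@idfun C) t) =
  tmap cofree_coder idfun t.
Proof. by rewrite tmap_comp; apply: eq_tmap. Qed.

Let tmap_univ_coderr t : tmap idfun univ_coder (tmap (@idfun C) univ_proj t) =
  tmap idfun cofree_coder t.
Proof. by rewrite tmap_comp; apply: eq_tmap. Qed.

Let univ_proj_comul c : univ_proj (Delta c) = 0.
Proof. by apply/eqP; rewrite qproj_eq0; apply/imlinP; exists c. Qed.

Let univ_lcoact_proj t :
  lcoact univ_codiff (univ_proj t) = tmap idfun univ_proj (cofree_lcoact t).
Proof. exact: (qliftE im_comul_lcoact). Qed.

Let univ_rcoact_proj t :
  rcoact univ_codiff (univ_proj t) = tmap univ_proj idfun (cofree_rcoact t).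
Proof. exact: (qliftE im_comul_rcoact). Qed.

Lemma univ_coder_coderivation : coderivation univ_coder.
Proof.
move=> x; rewrite -[x]qreprK -/(univ_proj _); move: (qrepr x) => t.
suff: Delta (univ_coder (univ_proj t)) =
    tmap univ_coder idfun (rcoact univ_codiff (univ_proj t)) +
    tmap idfun univ_coder (lcoact univ_codiff (univ_proj t)) by [].
rewrite univ_coder_proj univ_rcoact_proj univ_lcoact_proj.
rewrite tmap_univ_coderl tmap_univ_coderr.
apply: (tensor_ext (f := Delta \o cofree_coder) (g :=
  (tmap cofree_coder idfun \o cofree_rcoact) \+
  (tmap idfun cofree_coder \o cofree_lcoact))) => c d.
apply: etrans (_ : Delta (cofree_coder (c ⊗ d)) = _) _ => //.
rewrite cofree_coderE linearB !linearZ -[RHS]/(_ + _).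
rewrite [X in _ = X + _]coder_rcoact [X in _ = _ + X]coder_lcoact /=.
by rewrite addrA subrK scalerN.
Qed.

Let univ_codiffE x :
  x = univ_proj (tmap idfun univ_coder (lcoact univ_codiff x)).
Proof.
rewrite -[x]qreprK -/(univ_proj _) univ_lcoact_proj tmap_univ_coderr.
elim/tensor_ind: (qrepr x) => [|t t' IH IH'|c d].
- by rewrite !linear0.
- by move: IH IH'; rewrite !linearD /= => <- <-.
by rewrite coder_lcoact linearB linearZ /= univ_proj_comul scaler0 subr0.
Qed.

Lemma univ_codiff_unique (W : bicomodule C) (delta : {linear W -> C})
    (phi : {linear W -> univ_codiff}) :
  bicolinear phi -> (forall w, univ_coder (phi w) = delta w) ->
  forall w, phi w = univ_proj (tmap idfun delta (lcoact W w)).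
Proof.
move=> [phil _] phiE w; rewrite [LHS]univ_codiffE phil tmap_comp.
by congr univ_proj; apply: eq_tmap.
Qed.

Let counit_coder (W : bicomodule C) (delta : {linear W -> C}) :
  coderivation delta -> forall w, counit C (delta w) = 0.
Proof.
move=> der w.
have d0 : tunitl (tmap (counit C \o delta) idfun (rcoact W w)) = 0.
  have := counitl (delta w).
  rewrite der !linearD /= !tmap_comp -[RHS]add0r -[in RHS](lcoact_counit W w).
  suff -> : tunitl (tmap (counit C \o idfun) (idfun \o delta) (lcoact W w)) =
    delta (tunitl (tmap (counit C) idfun (lcoact W w))) by move/addIr.
  elim/tensor_ind: (lcoact W w) => [|t t' IH IH'|a b].
  - by rewrite !linear0.
  - by move: IH IH'; rewrite !linearD /= => -> ->.
  - by rewrite !tmapE /= !tunitlE linearZ.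
have := congr1 (counit C) d0; rewrite linear0 => <-.
rewrite -[in LHS](rcoact_counit W w).
elim/tensor_ind: (rcoact W w) => [|t t' IH IH'|a b].
- by rewrite !linear0.
- by move: IH IH'; rewrite !linearD /= => -> ->.
- rewrite !tmapE /= tunitrE tunitlE !linearZ; exact: mulrC.
Qed.

Definition univ_map (W : bicomodule C) (delta : {linear W -> C}) :
  {linear W -> univ_codiff} := univ_proj \o (tmap idfun delta \o lcoact W).

Lemma univ_mapP (W : bicomodule C) (delta : {linear W -> C}) :
  coderivation delta ->
  bicolinear (univ_map delta) /\
  (forall w, univ_coder (univ_map delta w) = delta w).
Proof.
move=> der; split; last first.
  move=> w; rewrite /= univ_coder_proj.
  rewrite -[LHS]/(tunitl (tmap _ _ _) - tunitr (tmap _ _ _)) !tmap_comp.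
  rewrite -[in RHS](lcoact_counit W w).
  elim/tensor_ind: (lcoact W w) => [|t t' IH IH'|a b].
  - by rewrite !linear0 addr0.
  - by move: IH IH'; rewrite !linearD /= => <- <-; rewrite addrACA.
  - rewrite !tmapE /= !tunitlE tunitrE [RHS]linearZ /= counit_coder //.
    by rewrite scale0r subr0.
have lE w : tmap Delta delta (lcoact W w) =
    tassocV (tmap idfun (tmap idfun delta) (tmap idfun (lcoact W) (lcoact W w))).
  rewrite -lcoactA tassocV_nat tassocK tmap_comp.
  by apply: eq_tmap => // c; rewrite /= tmap_id.
split=> w /=.
  rewrite univ_lcoact_proj -[cofree_lcoact _]/(tassoc (tmap _ _ _)) tmap_comp.
  rewrite -[tmap (_ \o _) _ _]/(tmap Delta delta _) lE tassocVK !tmap_comp.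
  exact: eq_tmap.
rewrite univ_rcoact_proj -[cofree_rcoact _]/(tassocV (tmap _ _ _)) tmap_comp.
have -> : tmap (idfun \o idfun) (Delta \o delta) (lcoact W w) =
    tmap idfun (tmap delta idfun) (tmap idfun (rcoact W) (lcoact W w)) +
    tmap idfun (tmap idfun delta) (tmap idfun (lcoact W) (lcoact W w)).
  rewrite !tmap_comp; elim/tensor_ind: (lcoact W w) => [|t t' IH IH'|a b].
  - by rewrite !linear0 addr0.
  - by move: IH IH'; rewrite !linearD /= => -> ->; rewrite addrACA.
  - by rewrite !tmapE /= der tensDr.
rewrite -coactA !linearD /= -lE tassocV_nat tassocK !tmap_comp.
rewrite [X in _ + X](_ : _ = 0) ?addr0; last first.
  elim/tensor_ind: (lcoact W w) => [|t t' IH IH'|a b].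
  - by rewrite !linear0.
  - by move: IH IH'; rewrite !linearD /= => -> ->; rewrite addr0.
  - by rewrite tmapE /= univ_proj_comul tens0l.
exact: eq_tmap.
Qed.

End UniversalCalculus.

(* Main.v *)
From HB Require Import structures.
Require Import Defs.
From mathcomp Require Import all_boot all_algebra.
From mathcomp Require Import boolp classical_sets.

(** Write psi w = w_(-1) ⊗ delta w_(0) for the map that a first-order
    codifferential calculus requires to be injective, delta_u for the universal
    coderivation, and lambda for the left coaction of the universal calculus.
    The map phi determines psi and conversely: phi w is the class of psi w by
    [univ_codiff_unique], and left colinearity of phi with
    delta = delta_u o phi gives psi w = (id ⊗ delta_u) (lambda (phi w)). Hence
    psi and phi are injective simultaneously ([focodc_iff_injective]).

    For the quotient, the same equivalence applies to the map
    W / ker phi -> univ_codiff induced by phi, which is injective. It remains to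
    see that ker phi is a subbicomodule. If phi w = 0, then id ⊗ phi kills the
    left coaction of w, and one must conclude that id ⊗ qproj kills it as well.
    This is the flatness of C over a field: the injection of W / ker phi into
    the universal calculus has a linear retraction ([linear_retraction], which
    in infinite dimension rests on Zorn's lemma), and tensoring with C preserves
    retractions. The right coaction is treated in the same way. *)

Set Implicit Arguments.
Unset Strict Implicit.
Unset Printing Implicit Defensive.

Import GRing.Theory.
Local Open Scope ring_scope.

Section LinearAlgebra.
Variable k : fieldType.

(** Zorn's lemma gives a maximal S among the sets closed under linear
    combinations that meet the image of f trivially. Maximality forces
    U = im f + S: a vector u outside the sum could be adjoined to S. *)
Lemma image_complement (V U : lmodType k) (f : {linear V -> U}) :
  injective f ->
  exists S : set U,
    [/\ forall a x y, S x -> S y -> S (a *: x + y),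
        forall v, S (f v) -> v = 0
      & forall u, exists v, S (u - f v)].
Proof.
move=> f_inj.
pose P (S : set U) := (forall a x y, S x -> S y -> S (a *: x + y)) /\
  (forall v, S (f v) -> v = 0).
have [|S [[S_lin S_f] S_max]] := @Zorn_bigcup _ P.
  move=> F FP F_tot; split=> [a x y [X FX Xx] [Y FY Yy]|v [X FX Xfv]].
    have [XY|YX] := F_tot _ _ FX FY.
      by exists Y => //; apply: (FP _ FY).1 => //; apply: XY.
    by exists X => //; apply: (FP _ FX).1 => //; apply: YX.
  exact: (FP _ FX).2 Xfv.
have SZ a x : S x -> S (a *: x).
  by move=> Sx; rewrite -[a](subrK 1) scalerDl scale1r; apply: S_lin.
(* The empty set satisfies P, so 0 \in S also comes from maximality. *)
have S0 : S 0.
  have S'P : P [set x : U | x = 0 \/ S x]%classic.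
    split=> [a x y [->|Sx] [->|Sy]|v [fv0|]]; last exact: S_f.
    - by left; rewrite scaler0 addr0.
    - by right; rewrite scaler0 add0r.
    - by right; rewrite addr0; apply: SZ.
    - by right; apply: S_lin.
    - by apply: f_inj; rewrite linear0.
  apply: contrapT => nS0; apply: (S_max _ _ S'P).
  by split=> [x Sx|sub]; [right|apply: nS0; apply: sub; left].
exists S; split=> // u; apply: contrapT => nSu.
have S'P : P [set x : U | exists a s, S s /\ x = a *: u + s]%classic.
  split=> [a _ _ [b [s [Ss ->]]] [c [t [St ->]]]|v [a [s [Ss fvE]]]].
    exists (a * b + c), (a *: s + t); split; first exact: S_lin.
    by rewrite scalerDr scalerDl scalerA addrACA.
  have [a0|a_neq0] := eqVneq a 0.
    by apply: S_f; rewrite fvE a0 scale0r add0r.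
  case: nSu; exists (a^-1 *: v).
  rewrite linearZ /= fvE scalerDr scalerA mulVf // scale1r opprD addNKr.
  by rewrite -scaleNr; apply: SZ.
apply: (S_max _ _ S'P); split=> [x Sx|sub].
  by exists 0, x; rewrite scale0r add0r.
apply: nSu; exists 0; rewrite linear0 subr0; apply: sub.
by exists 1, 0; rewrite scale1r addr0.
Qed.

(** The projection along a complement of the image. *)
Lemma linear_retraction (V U : lmodType k) (f : {linear V -> U}) :
  injective f -> exists g : {linear U -> V}, cancel f g.
Proof.
move=> f_inj; have [S [S_lin S_f S_cover]] := image_complement f_inj.
have [g gP] := choice S_cover.
have g_uniq u v : S (u - f v) -> g u = v.
  move=> Suv; apply/eqP; rewrite -subr_eq0; apply/eqP/S_f.
  have -> : f (g u - v) = -1 *: (u - f (g u)) + (u - f v).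
    by rewrite linearB scaleN1r opprB addrA subrK.
  exact: S_lin.
have S0 : S 0 by have := S_lin (-1) _ _ (gP 0) (gP 0); rewrite scaleN1r addNr.
have g_lin : linear g.
  move=> a x y; apply: g_uniq.
  by rewrite linearP opprD addrACA -scalerBr; exact: S_lin.
pose g' : {linear U -> V} :=
  HB.pack_for {linear U -> V} g (GRing.isLinear.Build k U V _ g g_lin).
by exists g' => v; apply: g_uniq; rewrite subrr.
Qed.

Lemma tmap_can (V V' W W' : lmodType k) (f : {linear V -> V'})
    (g : {linear W -> W'}) (f' : {linear V' -> V}) (g' : {linear W' -> W}) :
  cancel f f' -> cancel g g' -> cancel (tmap f g) (tmap f' g').
Proof.
move=> fK gK t; rewrite tmap_comp -[RHS]tmap_id.
by apply: eq_tmap.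
Qed.

(** Flatness of X, reduced to the fact that a retraction of f tensors to a
    retraction of id ⊗ f. *)
Lemma tmap_idl_inj (X V U : lmodType k) (f : {linear V -> U}) :
  injective f -> injective (tmap (@idfun X) f).
Proof.
move=> /linear_retraction[g fK].
have idK : cancel (@idfun X) (@idfun X) by [].
exact: can_inj (tmap_can idK fK).
Qed.

Lemma tmap_idr_inj (X V U : lmodType k) (f : {linear V -> U}) :
  injective f -> injective (tmap f (@idfun X)).
Proof.
move=> /linear_retraction[g fK].
have idK : cancel (@idfun X) (@idfun X) by [].
exact: can_inj (tmap_can fK idK).
Qed.

Section KernelFactorization.
Variables (V U : lmodType k) (f : {linear V -> U}).

Lemma kerlin_eq0 : {in kerlin f, forall v, f v = 0}.
Proof. by move=> v /eqP. Qed.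

Definition ker_factor : quotmod (kerlin f) -> U := qlift f.
HB.instance Definition _ := GRing.isLinear.Build k (quotmod (kerlin f)) U _
  ker_factor (qlift_is_linear kerlin_eq0).

Lemma ker_factorE v : ker_factor (qproj (kerlin f) v) = f v.
Proof. exact: (qliftE kerlin_eq0). Qed.

Lemma ker_factor_inj : injective ker_factor.
Proof.
move=> x y; rewrite -[x]qreprK -[y]qreprK !ker_factorE => /eqP fxy.
by apply/qprojP; rewrite inE linearB subr_eq0.
Qed.

End KernelFactorization.

End LinearAlgebra.

Arguments ker_factor {k V U} f x.

Section KernelBicomodule.
Variables (k : fieldType) (C : coalgebra k) (V W : bicomodule C).
Variables (f : {linear V -> W}) (f_bicolin : bicolinear f).

(** By colinearity id ⊗ f kills the left coaction of v. As f is qproj followed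
    by an injection, which stays injective after tensoring with C, already
    id ⊗ qproj kills it. *)
Lemma kerlin_lcoact : {in kerlin f, forall v,
  lcoact_proj (kerlin f : submodClosed V) v = 0}.
Proof.
move=> v /eqP fv0; apply: (tmap_idl_inj (@ker_factor_inj _ _ _ f)).
rewrite linear0 /lcoact_proj /= tmap_comp.
rewrite (eq_tmap (f' := idfun) (g' := f) (frefl _) (ker_factorE f)).
by rewrite -f_bicolin.1 fv0 linear0.
Qed.

Lemma kerlin_rcoact : {in kerlin f, forall v,
  rcoact_proj (kerlin f : submodClosed V) v = 0}.
Proof.
move=> v /eqP fv0; apply: (tmap_idr_inj (@ker_factor_inj _ _ _ f)).
rewrite linear0 /rcoact_proj /= tmap_comp.
rewrite (eq_tmap (f' := f) (g' := idfun) (ker_factorE f) (frefl _)).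
by rewrite -f_bicolin.2 fv0 linear0.
Qed.

Definition coim_bicomod : bicomodule C :=
  quot_bicomod kerlin_lcoact kerlin_rcoact.

Definition coim_proj : {linear V -> coim_bicomod} := qproj (kerlin f).

Definition coim_inj : {linear coim_bicomod -> W} := ker_factor f.

Lemma coim_proj_bicolinear : bicolinear coim_proj.
Proof.
by split=> v; [exact: (qliftE kerlin_lcoact)|exact: (qliftE kerlin_rcoact)].
Qed.

Lemma coim_inj_bicolinear : bicolinear coim_inj.
Proof.
split=> x; rewrite -[x]qreprK -/(coim_proj _); move: (qrepr x) => v.
  rewrite coim_proj_bicolinear.1 tmap_comp [coim_inj _]ker_factorE f_bicolin.1.
  by apply: eq_tmap => // w; rewrite /= [RHS]ker_factorE.
rewrite coim_proj_bicolinear.2 tmap_comp [coim_inj _]ker_factorE f_bicolin.2.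
by apply: eq_tmap => // w; rewrite /= [RHS]ker_factorE.
Qed.

End KernelBicomodule.

Section UniversalMap.
Variables (k : fieldType) (C : coalgebra k) (W : bicomodule C).
Variables (delta : {linear W -> C}) (phi : {linear W -> univ_codiff C}).
Hypothesis phi_bicolin : bicolinear phi.
Hypothesis phi_delta : forall w, univ_coder (phi w) = delta w.

Lemma coder_lcoactE w :
  tmap idfun delta (lcoact W w) =
  tmap idfun (@univ_coder k C) (lcoact (univ_codiff C) (phi w)).
Proof. by rewrite phi_bicolin.1 tmap_comp; apply: eq_tmap => // v; rewrite /= phi_delta. Qed.

Lemma coder_rcoactE w :
  tmap delta idfun (rcoact W w) =
  tmap (@univ_coder k C) idfun (rcoact (univ_codiff C) (phi w)).
Proof. by rewrite phi_bicolin.2 tmap_comp; apply: eq_tmap => // v; rewrite /= phi_delta. Qed.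

Lemma coderivation_of_univ : coderivation delta.
Proof.
move=> w; rewrite coder_lcoactE coder_rcoactE -phi_delta.
exact: univ_coder_coderivation.
Qed.

(** By [coder_lcoactE] the map w |-> w_(-1) ⊗ delta w_(0) factors through phi,
    and by [univ_codiff_unique] phi factors through it. *)
Lemma focodc_iff_injective : focodc delta <-> injective phi.
Proof.
split=> [[_ psi_inj] x y phi_xy|phi_inj].
  by apply: psi_inj => /=; rewrite !coder_lcoactE phi_xy.
split=> [|x y psi_xy]; first exact: coderivation_of_univ.
by apply: phi_inj; rewrite !(univ_codiff_unique phi_bicolin phi_delta) psi_xy.
Qed.

End UniversalMap.

Theorem proposition3p5 (k : fieldType) (char_k : 2%N \notin [pchar k])
    (C : coalgebra k) (W : bicomodule C)
    (delta : {linear W -> C}) (delta_coder : coderivation delta)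
    (phi : {linear W -> univ_codiff C}) (phi_bicolin : bicolinear phi)
    (phi_delta : forall w : W, univ_coder (phi w) = delta w) :
  (exists (B : bicomod_struct C (quotmod (kerlin phi)))
          (deltabar : {linear Bicomodule B -> C}),
    [/\ bicolinear (qproj (kerlin phi) : {linear W -> Bicomodule B}),
        forall w : W, deltabar (qproj (kerlin phi) w) = delta w
      & focodc deltabar]) /\
  (focodc delta <-> injective phi).
Proof.
split; last exact: focodc_iff_injective.
(* The induced coderivation is the restriction of the universal one along the
   injection of the quotient into the universal calculus. *)
exists (coim_bicomod phi_bicolin), (@univ_coder k C \o coim_inj phi_bicolin).
split.
- exact: coim_proj_bicolinear.
- by move=> w; rewrite -phi_delta -(ker_factorE phi w).
- apply/(focodc_iff_injective (coim_inj_bicolinear phi_bicolin)) => //.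
  exact: ker_factor_inj.
Qed.
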